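(* Let $\mathscr F_{\text{gruff}}=\{F_c,F_m,F_f,F_s,F_i\}$ be the family of finitary operations on $\omega^\omega$ defined in the context, and let $\kappa$ be a regular cardinal. If there is a $\langle\mathfrak d,\mathscr F_{\text{gruff}},\kappa\rangle$-pathway, then there is a gruff ultrafilter.
   Context: For $f,g\in\omega^\omega$, $f\le^* g$ means $f(n)\le g(n)$ for all but finitely many $n$. The cardinal characteristic $\mathfrak d$ is identified with the triple $\langle\omega^\omega,\omega^\omega,\le^*\rangle$. For a collection $\mathscr F$ of finitary operations on $\omega^\omega$ (functions $F:(\omega^\omega)^n\to\omega^\omega$, $n<\omega$) and a regular cardinal $\kappa$, a $\langle\mathfrak d,\mathscr F,\kappa\rangle$-pathway is an increasing continuous sequence $\langle B_\alpha : \alpha<\kappa\rangle$ of subsets of $\omega^\omega$ (continuous: $B_\alpha=\bigcup_{\xi<\alpha}B_\xi$ for limit $\alpha$) such that (1) $\bigcup_{\alpha<\kappa}B_\alpha=\omega^\omega$; (2) for every $\alpha<\kappa$ there is $x\in\omega^\omega$ with $x\not\le^* y$ for all $y\in B_\alpha$; (3) each $B_\alpha$ is closed under every $F\in\mathscr F$. $\mathbb Q$ carries the topology inherited from $\mathbb R$. A subset of $\mathbb Q$ is crowded if it has no isolated points (in its subspace topology), perfect if it is closed in $\mathbb Q$ and crowded, and unbounded if it is unbounded above. An ultrafilter $u$ on $\mathbb Q$ is gruff if it has a base of perfect sets: $(\forall A\in u)(\exists P\in u)(P\text{ is perfect and }P\subseteq A)$. Fix an effective injective enumeration $\langle q_n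 : n<\omega\rangle$ of all of $\mathbb Q$. Fix functions $\mathrm{Code}:\omega^\omega\to\mathfrak P(\mathbb Q)$ and $\mathrm{Dcd}:\mathfrak P(\mathbb Q)\to\omega^\omega$ with $\mathrm{Code}\circ\mathrm{Dcd}=\mathrm{id}$. (For example, $\mathrm{Code}(f)=\{q_n : f(n)\ne0\}$ and $\mathrm{Dcd}(X)$ is the characteristic function of $\{n<\omega : q_n\in X\}$; the specific choice is immaterial.) For $f\in\omega^\omega$ and $n<\omega$ let $J_n^f=\left(q_n-\frac{\sqrt2}{k},\,q_n+\frac{\sqrt2}{k}\right)$, where $k$ is the least positive integer ensuring that $q_m\notin J_n^f$ for every $m\le f(n)$ with $m\ne n$. For $X\subseteq\mathbb Q$ let $$\mathrm{Shrink}(X,f)=\mathbb Q\setminus\bigcup_{q_n\notin X}J_n^f .$$ For $X\subseteq\mathbb Q$ let $f_X\in\omega^\omega$ be constantly $0$ if $X$ is not crowded and unbounded; otherwise $f_X(0)=\min\{k<\omega : q_k\in X\}$ and $f_X(n+1)$ is the least $k>f_X(n)$ such that both: - for every $i\le n$ with $q_i\in X$ there is $j\le k$ with $j>f_X(n)$, $q_j\in X$, $|q_i-q_j|<\frac1{2^n}$ and $q_j\notin\bigcup_{i<l\le n}J_l^{\mathrm{id}}$; and - there is $i\le k$ with $i>f_X(n)$, $q_i\in X$, $q_i>n+1$ and $q_i\notin\bigcup_{l\le n}J_l^{\mathrm{id}}$, where $\mathrm{id}$ is the identity function on $\omega$. For $X\subseteq\mathbb Q$, $M(X)$ denotes the maximal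 crowded unbounded subset of $X$ (with $M(X)=\varnothing$ if $X$ has no crowded unbounded subset). For $g,h\in\omega^\omega$ define: - $F_c(h)=\mathrm{Dcd}(\mathbb Q\setminus\mathrm{Code}(h))$; - $F_m(h)=\mathrm{Dcd}(M(\mathrm{Code}(h)))$; - $F_f(h)=f_{\mathrm{Code}(h)}$; - $F_s(g,h)=\mathrm{Dcd}(\mathrm{Shrink}(\mathrm{Code}(g),h))$; - $F_i(g,h)=\mathrm{Dcd}(\mathrm{Code}(g)\cap\mathrm{Code}(h))$. *)

(* Defs.v *)
From mathcomp Require Import all_boot all_order all_algebra.
From mathcomp Require Import all_classical all_reals all_analysis.
From mathcomp Require Import wochoice.

Set Implicit Arguments.
Unset Strict Implicit.
Unset Printing Implicit Defensive.

Import Order.TTheory GRing.Theory Num.Theory.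
Import numFieldNormedType.Exports.

Local Open Scope classical_set_scope.
Local Open Scope ring_scope.
Local Open Scope card_scope.

Definition baire : Type := nat -> nat.

Definition le_star (f g : baire) : Prop := \forall n \near \oo, (f n <= g n)%N.

(* An ordinal is represented by a well-ordered type, its elements being the
   smaller ordinals.  It is a regular cardinal when it is infinite, is not
   equinumerous with any proper initial segment (so it is a cardinal), and
   every cofinal subset has full cardinality (so it is its own cofinality). *)
Definition regular_cardinal (d : Order.disp_t) (K : orderType d) : Prop :=
  [/\ well_order (<=%O : rel K),
      infinite_set [set: K],
      forall a : K, ~ ([set b : K | (b < a)%O] #= [set: K])
    & forall A : set K,
        (forall a : K, exists2 b : K, A b & (a <= b)%O) -> A #= [set: K]].

Definition is_limit (d : Order.disp_t) (K : orderType d) (a : K) : Prop :=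
  (exists b : K, (b < a)%O) /\
  (forall b : K, (b < a)%O -> exists2 c : K, (b < c)%O & (c < a)%O).

Definition operation : Type := {n : nat & ('I_n -> baire) -> baire}.

Definition unary (F : baire -> baire) : operation :=
  existT (fun n => ('I_n -> baire) -> baire) 1%N (fun v => F (v ord0)).

Definition binary (F : baire -> baire -> baire) : operation :=
  existT (fun n => ('I_n -> baire) -> baire) 2%N (fun v => F (v ord0) (v ord_max)).

Definition closed_under (B : set baire) (F : operation) : Prop :=
  forall v : 'I_(projT1 F) -> baire, (forall i, B (v i)) -> B (projT2 F v).

Definition d_pathway (d : Order.disp_t) (K : orderType d) (FF : set operation)
    (B : K -> set baire) : Prop :=
  [/\ forall a b : K, (a <= b)%O -> B a `<=` B b,
      forall a : K, is_limit a -> B a = \bigcup_(xi in [set xi | (xi < a)%O]) B xi,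
      \bigcup_a B a = [set: baire],
      forall a : K, exists x : baire, forall y : baire, B a y -> ~ le_star x y
    & forall (a : K) (F : operation), FF F -> closed_under (B a) F].

(* The rationals with the topology inherited from the reals; the library puts
   no topology on [rat] itself. *)
Notation rat_top R := (initial_topology (@ratr R : rat -> R)).

Definition crowded (R : realType) (X : set rat) : Prop :=
  isolated (X : set (rat_top R)) = set0.

Definition perfect (R : realType) (X : set rat) : Prop :=
  closed (X : set (rat_top R)) /\ crowded R X.

Definition unbounded (X : set rat) : Prop := ~ has_ubound X.

Definition gruff (R : realType) (u : set_system rat) : Prop :=
  forall A : set rat, u A -> exists P : set rat, [/\ u P, perfect R P & P `<=` A].

(* Equal to 0 if [P] is empty. *)
Definition least (P : set nat) : nat :=
  xget 0%N [set k | P k /\ forall j, P j -> (k <= j)%N].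

Lemma leastP (P : set nat) :
  P !=set0 -> P (least P) /\ forall j, P j -> (least P <= j)%N.
Proof.
move=> [n Pn]; rewrite /least.
have [k /asboolP Pk kmin] : exists2 k, `[< P k >] & forall j, `[< P j >] -> (k <= j)%N.
  have exP : exists k, `[< P k >] by exists n; apply/asboolP.
  by exists (ex_minn exP); case: ex_minnP.
apply: (@xgetI _ 0%N [set k | P k /\ forall j, P j -> (k <= j)%N] k).
by split=> // j Pj; apply: kmin; apply/asboolP.
Qed.

Definition J_ball (R : realType) (q : nat -> rat) (n k : nat) : set R :=
  `](ratr (q n) - Num.sqrt 2 / k%:R), (ratr (q n) + Num.sqrt 2 / k%:R)[%classic.

Arguments J_ball : clear implicits.

Definition J (R : realType) (q : nat -> rat) (f : baire) (n : nat) : set R :=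
  J_ball R q n (least [set k | (0 < k)%N /\
    forall m, (m <= f n)%N -> m <> n -> ~ J_ball R q n k (ratr (q m))]).

Arguments J : clear implicits.

Definition Shrink (R : realType) (q : nat -> rat) (X : set rat) (f : baire) :
    set rat :=
  ~` \bigcup_(n in [set n | ~ X (q n)]) [set x : rat | J R q f n (ratr x)].

Fixpoint f_set_rec (R : realType) (q : nat -> rat) (X : set rat) (n : nat) : nat :=
  match n with
  | 0 => least [set k | X (q k)]
  | n'.+1 =>
    let p := f_set_rec R q X n' in
    least [set k | [/\ (p < k)%N,
      forall i, (i <= n')%N -> X (q i) ->
        exists j, [/\ (j <= k)%N, (p < j)%N, X (q j),
          `|q i - q j| < 1 / 2 ^+ n'
          & forall l, (i < l <= n')%N -> ~ J R q id l (ratr (q j))]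
      & exists i, [/\ (i <= k)%N, (p < i)%N, X (q i),
          n'.+1%:R < q i
          & forall l, (l <= n')%N -> ~ J R q id l (ratr (q i))]]]
  end.

Definition f_set (R : realType) (q : nat -> rat) (X : set rat) : baire :=
  fun n => if `[< crowded R X /\ unbounded X >] then f_set_rec R q X n else 0%N.

(* [set0] if [X] has no crowded unbounded subset. *)
Definition M (R : realType) (X : set rat) : set rat :=
  xget set0 [set Y | [/\ crowded R Y, unbounded Y, Y `<=` X &
    forall Z, crowded R Z -> unbounded Z -> Z `<=` X -> Y `<=` Z -> Z = Y]].

Definition F_gruff (R : realType) (q : nat -> rat)
    (Code : baire -> set rat) (Dcd : set rat -> baire) : set operation :=
  [set unary (fun h => Dcd (~` Code h));
       unary (fun h => Dcd (M R (Code h)));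
       unary (fun h => f_set R q (Code h));
       binary (fun g h => Dcd (Shrink R q (Code g) h));
       binary (fun g h => Dcd (Code g `&` Code h))].

(* Main.v *)
Require Import Defs.
From mathcomp Require Import all_boot all_order all_algebra.
From mathcomp Require Import all_classical all_reals all_analysis.
From mathcomp Require Import zify.

(** Call a set of rationals large if it contains a crowded unbounded set.  The
    sets that are not large form an ideal ([large_setU]): away from a bound, a
    set with no crowded unbounded subset is scattered, and a union of two
    scattered sets is scattered.  Hence ultrafilters consisting of large sets
    abound.

    Along the pathway, let [alg a] be the family of the sets coded in [B a]; it
    is a Boolean algebra, and these algebras increase to the whole power set.
    The ultrafilter is the union of an increasing sequence of ultrafilters on
    the algebras, all of whose members are large, such that each member at one
    stage contains a perfect set that belongs to the next stage.  Unions take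
    care of limit stages, by continuity of the pathway; the whole point is the
    successor step ([ultra_on_extend]).

    Given an ultrafilter [v] of large sets on [alg a], take an increasing [x]
    that no element of [B a] dominates.  Since [Shrink X x] deletes around each
    [q n] outside [X] an interval that does not depend on [X], it commutes with
    finite intersections ([Shrink_setI]); so the sets [Shrink X x], for [X] in
    [v], generate a filter of large sets as soon as each of them is large, and
    this filter extends to an ultrafilter that contains [v].  Now [M X] is again
    in [v], because the remainder [X \ M X] is not large, and [f_set (M X)]
    lies in [B a].  It remains to see that, for [X] crowded and unbounded,
    [Shrink X x] is perfect and unbounded whenever [f_set X] does not dominate
    [x] ([crowded_Shrink], [unbounded_Shrink]).  Whenever [f_set X] falls below
    [x] at [n + 1], the definition of [f_set] provides, between its values at
    [n] and [n + 1], indices of points of [X] that are close to a given earlier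
    point of [Shrink X x], or are large.  These points survive: the intervals
    of index above [n] avoid them because [x] is large there, and those of
    index at most [n] by the choice of the points, except for finitely many
    intervals whose closures miss the given point, as their end points are
    irrational. *)

Set Implicit Arguments.
Unset Strict Implicit.
Unset Printing Implicit Defensive.

Import Order.TTheory GRing.Theory Num.Theory.
Import numFieldNormedType.Exports.

Local Open Scope classical_set_scope.
Local Open Scope ring_scope.

(** * Topology of the rationals *)

Lemma filter_forall_leq (T : Type) (F : set_system T) {FF : Filter F}
    (P : nat -> set T) n :
  (forall m, (m <= n)%N -> F (P m)) ->
  F [set t | forall m, (m <= n)%N -> P m t].
Proof.
move=> FP; elim: n FP => [|n IH] FP.
  by apply: filterS (FP 0%N _) => // t Pt m; rewrite leqn0 => /eqP ->.
have FPn m : (m <= n)%N -> F (P m) by move=> mn; apply: FP; exact: leqW.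
apply: filterS (filterI (IH FPn) (FP n.+1 (leqnn _))) => t [Pt Ptn] m.
by rewrite leq_eqVlt => /predU1P[->//|]; exact: Pt.
Qed.

Lemma sqrt2_irrational (R : realType) (r : rat) : ratr r <> Num.sqrt 2 :> R.
Proof.
move=> rE; have : (ratr (r ^+ 2) : R) = ratr 2.
  by rewrite (rmorphXn (@ratr R)) /= rE sqr_sqrtr ?ler0n// ratr_nat.
move=> /(fmorph_inj (@ratr R)) r2.
have : numq r ^+ 2 = 2 * denq r ^+ 2.
  by apply: (@intr_inj rat); rewrite rmorphXn intrM rmorphXn /= numqE exprMn r2.
move=> /(congr1 absz); rewrite abszM !abszX => nd.
have d0 : (0 < `|denq r|)%N by rewrite absz_gt0 denq_neq0.
(* The exponent of 2 is even on the left-hand side, odd on the right. *)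
have /(congr1 (fun k => odd (logn 2 k))) := nd.
by rewrite lognM ?expn_gt0 ?d0// !lognX oddD !oddM.
Qed.

Section RationalTopology.
Variable R : realType.

Lemma near_ratr (x : rat) (A : set R) :
  nbhs (ratr x : R) A -> \forall y \near (x : rat_top R), A (ratr (y : rat)).
Proof. exact: initial_continuous. Qed.

Lemma near_dist (x e : rat) : 0 < e ->
  \forall y \near (x : rat_top R), `|x - (y : rat)| < e.
Proof.
move=> e0; have e0R : 0 < ratr e :> R by rewrite ltr0q.
apply: filterS (near_ratr (nbhsx_ballx _ _ e0R)) => y.
by rewrite /ball /= -rmorphB -ratr_norm ltr_rat.
Qed.

Lemma near_neq (x z : rat) : z <> x ->
  \forall y \near (x : rat_top R), z <> (y : rat).
Proof.
move=> /eqP zx; have d0 : 0 < `|x - z| by rewrite normr_gt0 subr_eq0 eq_sym.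
by apply: filterS (near_dist _ d0) => y /[swap] <-; rewrite ltxx.
Qed.

Lemma near_gt (b x : rat) : b < x ->
  \forall y \near (x : rat_top R), b < (y : rat).
Proof.
move=> bx; have d0 : 0 < x - b by rewrite subr_gt0.
apply: filterS (near_dist _ d0) => y.
by rewrite ltr_norml => /andP[_]; rewrite ltrD2l ltrN2.
Qed.

(** Dyadic radii suffice, and they are the ones that occur in [f_set]. *)
Lemma near_dyadic (x : rat) (V : set rat) : nbhs (x : rat_top R) V ->
  \forall n \near \oo, forall y, `|x - y| < 1 / 2 ^+ n -> V y.
Proof.
move=> [_ [[A oA <-] Ax] AV].
have [e /= e0 eA] := (nbhs_ballP _ _).1 (open_nbhs_nbhs (conj oA Ax)).
apply: filterS (near_infty_natSinv_expn_lt (PosNum e0)) => n ne y xy.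
apply: AV; apply: eA; apply: lt_trans ne.
move: xy; rewrite -(ltr_rat R) ratr_norm fmorph_div rmorphXn rmorph1 /= ratr_nat.
by rewrite rmorphB.
Qed.

Lemma crowdedP (X : set rat) :
  crowded R X <-> forall x, X x -> forall V : set rat,
    nbhs (x : rat_top R) V -> exists y, [/\ X y, y <> x & V y].
Proof.
split=> [cX x Xx V Vx|H].
  apply: contrapT => noy.
  suff : isolated (X : set (rat_top R)) x by rewrite cX.
  split; first exact/mem_set.
  exists V => //; apply/seteqP; split=> [y [Vy Xy]|y ->] /=.
    by apply: contrapT => yx; apply: noy; exists y.
  by split=> //; exact: nbhs_singleton Vx.
apply/seteqP; split=> // x [/set_mem Xx [V Vx VX]].
have [y [Xy yx Vy]] := H _ Xx _ Vx.
by apply: yx; have : [set x] y by rewrite -VX; split.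
Qed.

Lemma crowded_setI (X V : set rat) : crowded R X ->
  (forall x, X x -> V x -> nbhs (x : rat_top R) V) -> crowded R (X `&` V).
Proof.
move=> /crowdedP cX oV; apply/crowdedP => x [Xx Vx] U Ux.
have [y [Xy yx [Uy Vy]]] := cX _ Xx _ (filterI Ux (oV _ Xx Vx)).
by exists y.
Qed.

Lemma crowded_bigcup (S : set_system rat) :
  (forall X, S X -> crowded R X) -> crowded R (\bigcup_(X in S) X).
Proof.
move=> cS; apply/crowdedP => x [X SX Xx] V Vx.
have [y [Xy yx Vy]] := (crowdedP X).1 (cS _ SX) _ Xx _ Vx.
by exists y; split=> //; exists X.
Qed.

Lemma crowded_setU (X Y : set rat) :
  crowded R X -> crowded R Y -> crowded R (X `|` Y).
Proof.
move=> cX cY; rewrite -(bigcup_set1 id X) -(bigcup_set1 id Y) -bigcup_setU.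
by apply: crowded_bigcup => Z [|] ->.
Qed.

Lemma crowded_setT : crowded R [set: rat].
Proof.
apply/crowdedP => x _ V /near_dyadic[n _ /(_ n (leqnn n)) nV].
have e0 : 0 < 1 / 2 ^+ n.+1 :> rat by rewrite divr_gt0 ?exprn_gt0.
exists (x + 1 / 2 ^+ n.+1); split=> //.
  by move/eqP; rewrite -subr_eq0 addrC addKr gt_eqF.
apply: nV; rewrite opprD addNKr normrN gtr0_norm//.
by rewrite !mul1r ltf_pV2 ?posrE ?exprn_gt0// ltr_eXn2l.
Qed.

End RationalTopology.

Lemma unboundedP (X : set rat) :
  unbounded X <-> forall b, exists2 x, X x & b < x.
Proof.
split=> [uX b|uX [b bX]]; last first.
  by have [x Xx] := uX b; rewrite ltNge => /negP; apply; exact: bX.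
apply: contrapT => nox; apply: uX; exists b => x Xx.
by rewrite leNgt; apply/negP => bx; apply: nox; exists x.
Qed.

Lemma unboundedS (X Y : set rat) : X `<=` Y -> unbounded X -> unbounded Y.
Proof. by move=> XY uX [b bY]; apply: uX; exists b => x /XY; exact: bY. Qed.

Lemma unbounded_setT : unbounded [set: rat].
Proof. by apply/unboundedP => b; exists (b + 1) => //; rewrite ltrDl. Qed.

(** * The ideal of the sets without crowded unbounded subsets *)

Section Large.
Variable R : realType.

Definition large (X : set rat) : Prop :=
  exists Y, [/\ crowded R Y, unbounded Y & Y `<=` X].

Lemma largeS (X Y : set rat) : X `<=` Y -> large X -> large Y.
Proof. by move=> XY [Z [cZ uZ ZX]]; exists Z; split=> // x /ZX/XY. Qed.

Lemma large_setT : large [set: rat].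
Proof.
by exists setT; split=> //; [exact: crowded_setT|exact: unbounded_setT].
Qed.

Lemma large_nonempty (X : set rat) : large X -> X !=set0.
Proof.
by move=> [Y [_ /unboundedP /(_ 0)[x Yx _] YX]]; exists x; exact: YX.
Qed.

(** The largest crowded subset of [X]; the rest of [X] is scattered. *)
Definition kernel (X : set rat) : set rat :=
  \bigcup_(Y in [set Y | crowded R Y /\ Y `<=` X]) Y.

Lemma kernel_crowded X : crowded R (kernel X).
Proof. by apply: crowded_bigcup => Y []. Qed.

Lemma kernel_sub X : kernel X `<=` X.
Proof. by move=> x [Y [_ YX]] /YX. Qed.

Lemma sub_kernel X Y : crowded R Y -> Y `<=` X -> Y `<=` kernel X.
Proof. by move=> cY YX y Yy; exists Y. Qed.

Lemma kernel_unbounded X : large X -> unbounded (kernel X).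
Proof. by move=> [Y [cY uY YX]]; apply: unboundedS uY; exact: sub_kernel. Qed.

(** Scattered sets form an ideal.  If [C] misses both kernels, then [C `&` X]
    has an isolated point [b], which is not isolated in [C]; so a punctured
    neighbourhood of [b] meets [C] in a nonempty crowded subset of [Y]. *)
Lemma kernel_setU (X Y C : set rat) : crowded R C -> C !=set0 ->
  C `<=` X `|` Y -> (C `&` (kernel X `|` kernel Y)) !=set0.
Proof.
move=> cC [c Cc] CXY; apply: contrapT => disj.
have CXE D : crowded R D -> D `<=` C -> D `<=` X -> D `<=` set0.
  move=> cD DC DX d Dd; apply: disj; exists d; split; first exact: DC.
  by left; exact: (sub_kernel cD).
have CYE D : crowded R D -> D `<=` C -> D `<=` Y -> D `<=` set0.
  move=> cD DC DY d Dd; apply: disj; exists d; split; first exact: DC.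
  by right; exact: (sub_kernel cD).
have [a Ca Xa] : exists2 a, C a & X a.
  apply: contrapT => noa; apply: (CYE C) Cc => // x Cx.
  by have [Xx|//] := CXY _ Cx; exfalso; apply: noa; exists x.
have ncCX : ~ crowded R (C `&` X).
  by move=> cCX; apply: (CXE _ cCX) (conj Ca Xa) => x [].
have [b [[Cb Xb] [V bV VX]]] : exists b, (C `&` X) b /\ exists2 V : set rat,
    nbhs (b : rat_top R) V & forall y, V y -> C y -> X y -> y = b.
  apply: contrapT => nob; apply: ncCX; apply/crowdedP => b CXb V bV.
  apply: contrapT => noy; apply: nob; exists b; split=> //.
  exists V => // y Vy Cy Xy.
  by apply: contrapT => yb; apply: noy; exists y.
pose U := [set y : rat | @interior (rat_top R) V y /\ b <> y].
have cCU : crowded R (C `&` U).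
  apply: crowded_setI => // x Cx [Vx bx].
  by apply: filterI; [exact: (@nbhs_interior (rat_top R))|exact: near_neq].
have [y [Cy yb Vy]] :=
  (crowdedP R C).1 cC _ Cb _ (@nbhs_interior (rat_top R) _ _ bV).
apply: (CYE _ cCU _ _ y) => [x [] //|x [Cx [/interior_subset Vx bx]]|].
  by have [Xx|//] := CXY _ Cx; exfalso; apply/bx/esym/VX.
by split=> //; split=> // yb'; apply: yb.
Qed.

(** If the kernel of [X] is bounded by [b], then the part of a crowded
    unbounded subset of the union that lies above [b] can only meet the kernel
    of [Y], and it does so arbitrarily far. *)
Lemma large_setU (X Y : set rat) : large (X `|` Y) -> large X \/ large Y.
Proof.
move=> [C [cC uC CXY]].
have [uX|bX] := pselect (unbounded (kernel X)).
  by left; exists (kernel X); split=> //; [exact: kernel_crowded|exact: kernel_sub].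
right; exists (kernel Y); split; [exact: kernel_crowded| |exact: kernel_sub].
move: bX => /contrapT[b bX]; apply/unboundedP => a.
pose V := [set x : rat | Num.max a b < x].
have oV (x : rat) : V x -> nbhs (x : rat_top R) V by exact: near_gt.
have cCV : crowded R (C `&` V) by apply: crowded_setI => // x _; exact: oV.
have CV0 : (C `&` V) !=set0.
  by have [c Cc Vc] := (unboundedP C).1 uC (Num.max a b); exists c.
have [x [[_ Vx] kx]] := kernel_setU cCV CV0 (subset_trans (@subIsetl _ C V) CXY).
move: Vx; rewrite /V /= gt_max => /andP[ax bx]; exists x => //.
by case: kx => // /bX; rewrite leNgt bx.
Qed.

(** The kernel of [X] is a maximal crowded unbounded subset of [X], so that the
    choice made in [M] is a legitimate one. *)
Lemma M_spec (X : set rat) : large X ->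
  [/\ crowded R (M R X), unbounded (M R X), M R X `<=` X &
    forall Z, crowded R Z -> unbounded Z -> Z `<=` X -> M R X `<=` Z -> Z = M R X].
Proof.
move=> lX; rewrite /M; set P := [set Y | _].
apply: (@xgetI _ set0 P (kernel X)).
split; [exact: kernel_crowded|exact: kernel_unbounded|exact: kernel_sub|].
by move=> Z cZ _ ZX kZ; apply/seteqP; split=> //; exact: sub_kernel.
Qed.

(** A crowded unbounded set disjoint from [M R X] could be added to it. *)
Lemma notlarge_setDM (X : set rat) : large X -> ~ large (X `\` M R X).
Proof.
move=> lX [Z [cZ uZ ZXM]]; have [cM uM MX maxM] := M_spec lX.
have ZM : Z `|` M R X = M R X.
  apply: maxM; [exact: crowded_setU|exact: unboundedS uM| |exact: subsetUr].
  by move=> x [/ZXM[]|/MX].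
have [z Zz _] := (unboundedP Z).1 uZ 0.
by have [_ []] := ZXM _ Zz; rewrite -ZM; left.
Qed.

End Large.

(** * Ultrafilters of large sets *)

Lemma ultra_of_complement (T : Type) (u : set_system T) :
  ~ u set0 -> (forall A B, u A -> u B -> u (A `&` B)) ->
  (forall A, u A \/ u (~` A)) -> UltraFilter u.
Proof.
move=> u0 uI uC; have uS A B : A `<=` B -> u A -> u B.
  move=> AB uA; have [//|uB] := uC B.
  have := uI _ _ uA uB; suff -> : A `&` ~` B = set0 by [].
  by rewrite -subset0 => x [/AB].
have uT : u setT by have [//|] := uC setT; rewrite setCT.
split=> [|G GP uG]; first by split=> //; split.
apply/seteqP; split=> // A GA; have [//|/uG GnA] := uC A.
have : G (A `&` ~` A) by exact: filterI.
by rewrite setICr => /filter_not_empty.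
Qed.

(** The filter generated by [E] and the dual of the ideal of non-large sets is
    proper; an ultrafilter that extends it meets the ideal nowhere. *)
Lemma large_ultrafilter (R : realType) (E : set_system rat) : E !=set0 ->
  (forall A B, E A -> E B -> E (A `&` B)) -> E `<=` large R ->
  exists U, [/\ UltraFilter U, E `<=` U & U `<=` large R].
Proof.
move=> [A0 EA0] EI El.
pose G := [set S : set rat | exists2 A, E A & ~ large R (A `\` S)].
have nl0 : ~ large R set0 by move=> /large_nonempty[].
have GF : ProperFilter G.
  split; first by move=> [A /El lA]; rewrite setD0.
  split=> [|S T [A EA AS] [B EB BT]|S T ST [A EA AS]].
  - by exists A0 => //; rewrite setDT.
  - exists (A `&` B); first exact: EI.
    by rewrite setDIr => /large_setU[] h; [apply: AS|apply: BT];
      apply: largeS h => x [[]].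
  - by exists A => // h; apply: AS; apply: largeS h => x [Ax nTx]; split=> // /ST.
have [U [UU GU]] := ultraFilterLemma GF.
exists U; split=> // [A EA|A UA].
  by apply: GU; exists A => //; rewrite setDv.
apply: contrapT => nA; have UnA : U (~` A).
  by apply: GU; exists A0 => // h; apply: nA; apply: largeS h => x [_ /contrapT].
have : U (A `&` ~` A) by exact: filterI.
by rewrite setICr => /filter_not_empty.
Qed.

(** * Shrinking a set along a function *)

Section Shrinking.
Variables (R : realType) (q : nat -> rat).
Hypothesis q_enum : bijective q.

Lemma J_ballP n k (y : R) :
  J_ball R q n k y <-> `|ratr (q n) - y| < Num.sqrt 2 / k%:R.
Proof. by rewrite /J_ball /= in_itv /= ltr_distlC. Qed.

Lemma J_ball_avoids n N : exists k, (0 < k)%N /\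
  forall m, (m <= N)%N -> m <> n -> ~ J_ball R q n k (ratr (q m)).
Proof.
have H m : \forall k \near \oo, m <> n -> ~ J_ball R q n k (ratr (q m)).
  have [->|mn] := pselect (m = n); first exact: nearW.
  pose e : R := `|ratr (q n) - ratr (q m)|.
  have e0 : 0 < e.
    rewrite normr_gt0 subr_eq0; apply/eqP => /(fmorph_inj (@ratr R)) qnm.
    by apply/mn/esym/(bij_inj q_enum).
  apply: filterS (filterI (nbhs_infty_ger (Num.sqrt 2 / e)) (nbhs_infty_gt 0)).
  move=> k [ek k0] _ /J_ballP; apply/negP; rewrite -leNgt -/e.
  by rewrite ler_pdivrMr ?ltr0n// mulrC -ler_pdivrMr.
have [k [k0 Hk]] := filter_ex (filterI (nbhs_infty_gt 0)
  (filter_forall_leq (fun m (_ : (m <= N)%N) => H m))).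
by exists k.
Qed.

Lemma J_spec f n : exists k, [/\ (0 < k)%N, J R q f n = J_ball R q n k,
  forall m, (m <= f n)%N -> m <> n -> ~ J_ball R q n k (ratr (q m)) &
  forall j, (0 < j)%N ->
    (forall m, (m <= f n)%N -> m <> n -> ~ J_ball R q n j (ratr (q m))) ->
    (k <= j)%N].
Proof.
rewrite /J; set P := [set k | _].
have P0 : P !=set0 by exact: J_ball_avoids.
have [[k0 kP] kmin] := leastP P0.
by exists (least P); split=> // j j0 jP; exact: kmin.
Qed.

Lemma J_center f n : J R q f n (ratr (q n)).
Proof.
have [k [k0 -> _ _]] := J_spec f n.
by apply/J_ballP; rewrite subrr normr0 divr_gt0 ?sqrtr_gt0 ?ltr0n.
Qed.

Lemma J_avoids f n m : (m <= f n)%N -> m <> n -> ~ J R q f n (ratr (q m)).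
Proof. by have [k [_ -> kP _]] := J_spec f n; exact: kP. Qed.

(** Requiring [J g n] to avoid more points can only make it smaller. *)
Lemma J_anti (f g : baire) n : (f n <= g n)%N -> J R q g n `<=` J R q f n.
Proof.
move=> fg; have [k [k0 -> _ kmin]] := J_spec f n.
have [l [l0 -> lP _]] := J_spec g n.
have kl : (k <= l)%N by apply: kmin => // m mf; apply: lP; exact: leq_trans mf fg.
move=> y /J_ballP yl; apply/J_ballP; apply: lt_le_trans yl _.
by rewrite ler_pM2l ?sqrtr_gt0 ?ltr0n// lef_pV2 ?posrE ?ltr0n ?ler_nat.
Qed.

Lemma J_open f n : open (J R q f n).
Proof. exact: interval_open. Qed.

(** The end points of the intervals are irrational, so a rational point outside
    an interval is outside its closure. *)
Lemma near_notJ f n (x : rat) : ~ J R q f n (ratr x) ->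
  \forall y \near (x : rat_top R), ~ J R q f n (ratr (y : rat)).
Proof.
have [k [k0 -> _ _]] := J_spec f n => /J_ballP/negP; rewrite -leNgt => xk.
have xk' : Num.sqrt 2 / k%:R < `|ratr (q n) - ratr x| :> R.
  rewrite lt_neqAle xk andbT; apply/eqP.
  rewrite -rmorphB -ratr_norm => xE.
  apply: (@sqrt2_irrational R (`|q n - x| * k%:R)).
  by rewrite rmorphM /= ratr_nat -xE divfK// pnatr_eq0 -lt0n.
have O : open [set y : R | Num.sqrt 2 / k%:R < `|ratr (q n) - y|].
  apply: (open_comp _ (@open_gt R (Num.sqrt 2 / k%:R))) => y _.
  by apply: cvg_norm; apply: cvgB; [exact: cvg_cst|exact: cvg_id].
apply: filterS (near_ratr (open_nbhs_nbhs (conj O xk'))) => y /= yk /J_ballP.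
by rewrite ltNge (ltW yk).
Qed.

Lemma pinfty_notJ f n : \forall y \near +oo, ~ J R q f n (ratr (y : rat)).
Proof.
have [k [k0 -> _ _]] := J_spec f n.
(* The radius is at most the square root of 2, hence less than 2. *)
exists (q n + 2); split=> [|y]; first exact: num_real.
rewrite -(ltr_rat R) rmorphD /= ratr_nat => qy /J_ballP; apply/negP.
rewrite -leNgt distrC (le_trans (y := 2)) ?(le_trans _ (ler_norm _))//; last first.
  by rewrite lerBrDl ltW.
have k1 : (1 : R) <= k%:R by rewrite ler1n.
rewrite ler_pdivrMr ?ltr0n// (le_trans (y := 2))//; last by rewrite ler_pMr.
by rewrite -[leRHS]ger0_norm// -sqrtr_sqr ler_wsqrtr// -natrX ler_nat.
Qed.

(** The candidates for [f_set R q X n.+1], once [f_set R q X n] is [p]. *)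
Definition f_step (X : set rat) (n p : nat) : set nat :=
  [set k | [/\ (p < k)%N,
    forall i, (i <= n)%N -> X (q i) ->
      exists j, [/\ (j <= k)%N, (p < j)%N, X (q j),
        `|q i - q j| < 1 / 2 ^+ n
        & forall l, (i < l <= n)%N -> ~ J R q id l (ratr (q j))]
    & exists i, [/\ (i <= k)%N, (p < i)%N, X (q i),
        n.+1%:R < q i
        & forall l, (l <= n)%N -> ~ J R q id l (ratr (q i))]]].

(** Points of [X] close to [q i] avoid the intervals of index above [i], whose
    closures miss [q i]; large points avoid any finite number of intervals; and
    in both cases finitely many indices can be excluded. *)
Lemma f_step_nonempty X n p : crowded R X -> unbounded X -> f_step X n p !=set0.
Proof.
have [q' qK q'K] := q_enum.
move=> /crowdedP cX /unboundedP uX.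
suff H : \forall k \near \oo, f_step X n p k by have [k] := filter_ex H; exists k.
have H1 := nbhs_infty_gt p.
have H2 i : (i <= n)%N -> \forall k \near \oo, X (q i) ->
    exists j, [/\ (j <= k)%N, (p < j)%N, X (q j), `|q i - q j| < 1 / 2 ^+ n
    & forall l, (i < l <= n)%N -> ~ J R q id l (ratr (q j))].
  move=> i_n; have [Xi|nXi] := pselect (X (q i)); last exact: nearW.
  have N1 : \forall y \near (q i : rat_top R), `|q i - (y : rat)| < 1 / 2 ^+ n.
    by apply: near_dist; rewrite divr_gt0 ?exprn_gt0.
  have N2 : \forall y \near (q i : rat_top R), forall m, (m <= p)%N -> m <> i ->
      q m <> (y : rat).
    apply: filter_forall_leq => m _; have [->|mi] := pselect (m = i).
      by apply: filterS filterT => y _ /(_ erefl).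
    have qmi : q m <> q i by move=> /(bij_inj q_enum).
    by apply: filterS (near_neq R qmi) => y ? _.
  have N3 : \forall y \near (q i : rat_top R), forall l, (l <= n)%N -> (i < l)%N ->
      ~ J R q id l (ratr (y : rat)).
    apply: filter_forall_leq => l _; have [il|li] := ltnP i l; last first.
      by apply: filterS filterT => y.
    have nJ : ~ J R q id l (ratr (q i)) by apply: J_avoids; [exact: ltnW|lia].
    by apply: filterS (near_notJ nJ) => y ? _.
  have [y [Xy yi [[yd ym] yJ]]] := cX _ Xi _ (filterI (filterI N1 N2) N3).
  apply: filterS (nbhs_infty_ge (q' y)) => k yk _; exists (q' y).
  rewrite q'K; split=> //.
    rewrite ltnNge; apply/negP => /ym; apply; last by rewrite q'K.
    by move=> yi'; apply: yi; rewrite -yi' q'K.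
  by move=> l /andP[il ln]; exact: yJ.
have H3 : \forall k \near \oo, exists i, [/\ (i <= k)%N, (p < i)%N, X (q i),
      n.+1%:R < q i & forall l, (l <= n)%N -> ~ J R q id l (ratr (q i))].
  have N1 : \forall y \near +oo, (n.+1%:R < y :> rat) by exact: nbhs_pinfty_gt.
  have N2 : \forall y \near +oo, forall m, (m <= p)%N -> q m < (y : rat).
    by apply: filter_forall_leq => m _; apply: nbhs_pinfty_gt; exact: num_real.
  have N3 : \forall y \near +oo, forall l, (l <= n)%N ->
      ~ J R q id l (ratr (y : rat)).
    by apply: filter_forall_leq => l _; exact: pinfty_notJ.
  have [b [_ bP]] := filterI (filterI N1 N2) N3.
  have [y Xy /bP[[ny ym] yJ]] := uX b.
  apply: filterS (nbhs_infty_ge (q' y)) => k yk; exists (q' y).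
  rewrite q'K; split=> //.
  by rewrite ltnNge; apply/negP => /ym; rewrite q'K ltxx.
apply: filterS (filterI (filterI H1 (filter_forall_leq H2)) H3) => k [[? ?] ?].
by split.
Qed.

Lemma f_setS X n : crowded R X -> unbounded X ->
  f_step X n (f_set R q X n) (f_set R q X n.+1).
Proof.
move=> cX uX; rewrite /f_set asboolT//=.
exact: (leastP (f_step_nonempty _ _ cX uX)).1.
Qed.

Lemma f_set_ge X n : crowded R X -> unbounded X -> (n <= f_set R q X n)%N.
Proof.
move=> cX uX; elim: n => // n IH.
by have [pk _ _] := f_setS n cX uX; exact: leq_ltn_trans IH pk.
Qed.

Lemma Shrink_sub X f : Shrink R q X f `<=` X.
Proof.
have [q' qK q'K] := q_enum.
move=> x xS; apply: contrapT => nXx; apply: xS.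
by exists (q' x); rewrite /= ?q'K//; have := J_center f (q' x); rewrite q'K.
Qed.

Lemma ShrinkS X Y f : X `<=` Y -> Shrink R q X f `<=` Shrink R q Y f.
Proof. by move=> XY x xS [n nY Jx]; apply: xS; exists n => // /XY. Qed.

(** The deleted interval around [q n] does not depend on the set, only the
    decision to delete it does. *)
Lemma Shrink_setI X Y f :
  Shrink R q (X `&` Y) f = Shrink R q X f `&` Shrink R q Y f.
Proof.
apply/seteqP; split=> [x xS|x [xX xY] [n nXY Jx]].
  by split; apply: ShrinkS xS => ? [].
have [Xn|nXn] := pselect (X (q n)); last by apply: xX; exists n.
by apply: xY; exists n => // Yn; exact: nXY.
Qed.

Lemma closed_Shrink X f : closed (Shrink R q X f : set (rat_top R)).
Proof.
apply: open_closedC; apply: bigcup_open => n _.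
by exists (J R q f n) => //; exact: J_open.
Qed.

Section Undominated.
Variables (X : set rat) (x : baire).
Hypotheses (cX : crowded R X) (uX : unbounded X).
Hypothesis x_mono : forall m n, (m <= n)%N -> (x m <= x n)%N.
Hypothesis x_id : forall n, (n <= x n)%N.
Hypothesis x_undominated : ~ le_star x (f_set R q X).

Lemma f_set_overtaken N : exists2 n, (N <= n)%N & (f_set R q X n.+1 < x n.+1)%N.
Proof.
apply: contrapT => H; apply: x_undominated; exists N.+1 => // -[//|n] /= Nn.
by rewrite leqNgt; apply/negP => fx; apply: H; exists n.
Qed.

(** The intervals of index above [n] take care of themselves: for [l > n] one
    has [j <= x l], so the point [q j] is among those that [J x l] avoids. *)
Lemma Shrink_intro n j : (f_set R q X n.+1 < x n.+1)%N ->
  (j <= f_set R q X n.+1)%N ->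
  X (q j) ->
  (forall l, (l <= n)%N -> ~ X (q l) -> ~ J R q x l (ratr (q j))) ->
  Shrink R q X x (q j).
Proof.
move=> fx jf Xj jJ [l nXl]; have [ln|nl] := leqP l n; first exact: jJ.
apply: J_avoids => [|jl]; last by apply: nXl; rewrite -jl.
by apply: leq_trans jf (leq_trans (ltnW fx) _); exact: x_mono.
Qed.

(** The neighbours of [q i] provided by [f_set] avoid the intervals [J id l],
    hence [J x l], only for [l] between [i] and [n].  They avoid the intervals
    of index below [i] because they are close to [q i], which is itself in the
    shrunken set. *)
Lemma crowded_Shrink : crowded R (Shrink R q X x).
Proof.
have [q' qK q'K] := q_enum.
apply/crowdedP => a; rewrite -(q'K a); set i := q' a => Si V Vi.
have Xi := Shrink_sub Si.
have N1 : \forall y \near (q i : rat_top R), forall l, (l <= i)%N -> ~ X (q l) ->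
    ~ J R q x l (ratr (y : rat)).
  apply: filter_forall_leq => l _; have [Xl|nXl] := pselect (X (q l)).
    by apply: filterS filterT => y _ /(_ Xl).
  have nJ : ~ J R q x l (ratr (q i)) by move=> Jl; apply: Si; exists l.
  by apply: filterS (near_notJ nJ) => y ? _.
have [N _ NV] := near_dyadic (filterI Vi N1).
(* N makes the neighbours close enough, i makes q i one of the points served. *)
have [n Nn fx] := f_set_overtaken (maxn N i).
move: Nn; rewrite geq_max => /andP[Nn i_n].
have [_ /(_ i i_n Xi)[j [jf fj Xj ij jJ]] _] := f_setS n cX uX.
have [Vj jJi] := NV _ Nn _ ij.
exists (q j); split=> //.
  apply: (Shrink_intro fx) => // l ln nXl.
  have [li|il] := leqP l i; first exact: jJi.
  by move/(J_anti (x_id l : (id l <= x l)%N)); apply: jJ; rewrite il.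
move=> /(bij_inj q_enum) ji; move: fj; rewrite ji ltnNge.
by rewrite (leq_trans i_n (f_set_ge n cX uX)).
Qed.

Lemma unbounded_Shrink : unbounded (Shrink R q X x).
Proof.
apply/unboundedP => b.
have [N bN] : exists N, b < N%:R.
  exists (Num.bound `|b|).
  exact: le_lt_trans (ler_norm _) (archi_boundP (normr_ge0 b)).
have [n Nn fx] := f_set_overtaken N.
have [_ _ [j [jf fj Xj nj jJ]]] := f_setS n cX uX.
exists (q j); last by apply: lt_trans bN (le_lt_trans _ nj); rewrite ler_nat leqW.
apply: (Shrink_intro fx) => // l ln nXl.
by move/(J_anti (x_id l : (id l <= x l)%N)); exact: jJ.
Qed.

End Undominated.
End Shrinking.

(** * The algebras along a pathway *)

Lemma unary_closed (B : set baire) (F : baire -> baire) h :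
  closed_under B (unary F) -> B h -> B (F h).
Proof. by move=> BF Bh; exact: (BF (fun=> h)). Qed.

Lemma binary_closed (B : set baire) (F : baire -> baire -> baire) g h :
  closed_under B (binary F) -> B g -> B h -> B (F g h).
Proof.
move=> BF Bg Bh; apply: (BF (fun i => if i == ord0 then g else h)) => i.
by case: (i == ord0).
Qed.

Lemma well_order_least (d : Order.disp_t) (K : orderType d) (S : set K) :
  wochoice.well_order (<=%O : rel K) -> S !=set0 ->
  exists2 m, S m & forall a, S a -> (m <= a)%O.
Proof.
move=> wo [a Sa]; have [|m [[/asboolP Sm mP] _]] := wo [pred a | `[< S a >]].
  by exists a; apply/asboolP.
by exists m => // b Sb; apply: mP; apply/asboolP.
Qed.

Lemma increasing_majorant (x : baire) : exists y : baire,
  [/\ forall m n, (m <= n)%N -> (y m <= y n)%N, forall n, (n <= y n)%N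
    & forall n, (x n <= y n)%N].
Proof.
exists (fun n => n + \sum_(i < n.+1) x i)%N; split=> [m n mn|n|n].
- rewrite leq_add// (big_ord_widen n.+1 x)//.
  by rewrite [leqRHS](bigID (fun i : 'I_n.+1 => (i < m.+1)%N))/= leq_addr.
- exact: leq_addr.
- by rewrite big_ord_recr addnA leq_addl.
Qed.

Section Construction.
Variables (R : realType) (q : nat -> rat).
Hypothesis q_enum : bijective q.
Variables (Code : baire -> set rat) (Dcd : set rat -> baire).
Hypothesis CodeK : cancel Dcd Code.
Variables (d : Order.disp_t) (K : orderType d).
Hypothesis K_wo : wochoice.well_order (<=%O : rel K).
Variable B : K -> set baire.
Hypothesis pathB : d_pathway (F_gruff R q Code Dcd) B.

Definition alg (a : K) : set_system rat := Code @` B a.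

(** [v] is an ultrafilter of large sets on the Boolean algebra [A].  The empty
    family qualifies when [A] is empty, as happens if the pathway starts with
    the empty set. *)
Definition ultra_on (A v : set_system rat) : Prop :=
  [/\ v `<=` A, forall X, A X -> v X \/ v (~` X),
    forall X Y, v X -> v Y -> v (X `&` Y) & v `<=` large R].

Definition refines (v w : set_system rat) : Prop :=
  v `<=` w /\ forall X, v X -> exists P, [/\ w P, perfect R P & P `<=` X].

Lemma algS a b : (a <= b)%O -> alg a `<=` alg b.
Proof.
by have [mB _ _ _ _] := pathB; move=> ab; apply: image_subset; exact: mB.
Qed.

Lemma alg_setC a X : alg a X -> alg a (~` X).
Proof.
have [_ _ _ _ cB] := pathB; move=> [h Bh <-].
exists (Dcd (~` Code h)); last by rewrite CodeK.
by apply: (unary_closed (F := fun h => Dcd (~` Code h))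
  (cB a _ _) Bh); do 4!left.
Qed.

Lemma alg_M a X : alg a X -> alg a (M R X).
Proof.
have [_ _ _ _ cB] := pathB; move=> [h Bh <-].
exists (Dcd (M R (Code h))); last by rewrite CodeK.
by apply: (unary_closed (F := fun h => Dcd (M R (Code h)))
  (cB a _ _) Bh); do 3!left; right.
Qed.

Lemma alg_f_set a X : alg a X -> B a (f_set R q X).
Proof.
have [_ _ _ _ cB] := pathB; move=> [h Bh <-].
by apply: (unary_closed (F := fun h => f_set R q (Code h))
  (cB a _ _) Bh); do 2!left; right.
Qed.

Lemma alg_Shrink a X x : alg a X -> B a x -> alg a (Shrink R q X x).
Proof.
have [_ _ _ _ cB] := pathB; move=> [h Bh <-] Bx.
exists (Dcd (Shrink R q (Code h) x)); last by rewrite CodeK.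
by apply: (binary_closed (F := fun g h => Dcd (Shrink R q (Code g) h))
  (cB a _ _) Bh Bx); left; right.
Qed.

Lemma alg_setI a X Y : alg a X -> alg a Y -> alg a (X `&` Y).
Proof.
have [_ _ _ _ cB] := pathB; move=> [g Bg <-] [h Bh <-].
exists (Dcd (Code g `&` Code h)); last by rewrite CodeK.
by apply: (binary_closed (F := fun g h => Dcd (Code g `&` Code h))
  (cB a _ _) Bg Bh); right.
Qed.

Lemma alg_cover X : exists a, alg a X.
Proof.
have [_ _ cB _ _] := pathB.
have [a _ Ba] : (\bigcup_a B a) (Dcd X) by rewrite cB.
by exists a, (Dcd X).
Qed.

Lemma ultra_on_trace (U : set_system rat) a :
  UltraFilter U -> U `<=` large R -> ultra_on (alg a) (U `&` alg a).
Proof.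
move=> UU Ul; split=> [X []//|X aX|X Y [UX aX] [UY aY]|X [/Ul]//].
  have [UX|UX] := in_ultra_setVsetC X UU; first by left.
  by right; split=> //; exact: alg_setC.
by split; [exact: filterI|exact: alg_setI].
Qed.

Lemma ultra_on_bigcup (I : Type) (S : set I) (A v : I -> set_system rat) :
  (forall i, S i -> ultra_on (A i) (v i)) ->
  (forall i j, S i -> S j -> v i `<=` v j \/ v j `<=` v i) ->
  ultra_on (\bigcup_(i in S) A i) (\bigcup_(i in S) v i).
Proof.
move=> Su Sc; split=> [X [i Si vX]|X [i Si AX]|X Y [i Si vX] [j Sj vY]|X [i Si vX]].
- by have [vA _ _ _] := Su _ Si; exists i => //; exact: vA.
- by have [_ vC _ _] := Su _ Si; have [vX|vX] := vC _ AX; [left|right]; exists i.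
- have [ij|ji] := Sc _ _ Si Sj.
    by have [_ _ vI _] := Su _ Sj; exists j => //; apply: vI => //; exact: ij.
  by have [_ _ vI _] := Su _ Si; exists i => //; apply: vI => //; exact: ji.
- by have [_ _ _ vl] := Su _ Si; exact: vl.
Qed.

(** The remainder is not large, so it cannot be in [v]. *)
Lemma ultra_on_M a v X : ultra_on (alg a) v -> v X -> v (M R X).
Proof.
move=> [vA vC vI vl] vX; have [//|vMC] := vC _ (alg_M (vA _ vX)).
by exfalso; apply: (notlarge_setDM (vl _ vX)); rewrite setDE; apply/vl/vI.
Qed.

(** The successor step.  The next stage is any [b] such that [B b] contains a
    function [x] that [B a] does not dominate; enlarging [x] makes it increasing
    and above the identity. *)
Lemma ultra_on_extend a v : ultra_on (alg a) v ->
  exists b w, [/\ (a < b)%O, ultra_on (alg b) w & refines v w].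
Proof.
have [mB _ cB uB _] := pathB; move=> uv; have [vA vC vI vl] := uv.
have [x0 x0B] := uB a.
have [x [x_mono x_id x0x]] := increasing_majorant x0.
have xB y : B a y -> ~ le_star x y.
  by move=> /x0B; apply: contra_not; apply: filterS => n; exact: leq_trans.
have [b _ Bx] : (\bigcup_b B b) x by rewrite cB.
have ab : (a < b)%O.
  rewrite ltNge; apply/negP => /mB/(_ _ Bx)/xB; apply; exact: nearW.
have SMP X : v X -> [/\ crowded R (Shrink R q (M R X) x),
    unbounded (Shrink R q (M R X) x) & Shrink R q (M R X) x `<=` Shrink R q X x].
  move=> vX; have [cM uM MX _] := M_spec (vl _ vX).
  have xM : ~ le_star x (f_set R q (M R X)).
    by apply/xB/alg_f_set/alg_M/vA.
  split; [exact: crowded_Shrink|exact: unbounded_Shrink|exact: ShrinkS].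
(* setT makes E nonempty even if v is empty. *)
pose E : set_system rat := [set setT] `|` [set Shrink R q X x | X in v].
have [|||U [UU EU Ul]] := @large_ultrafilter R E.
- by exists setT; left.
- move=> Y Z [->|[X vX <-]] [->|[X' vX' <-]]; rewrite ?setIT ?setTI.
  + by left.
  + by right; exists X'.
  + by right; exists X.
  + by right; exists (X `&` X'); [exact: vI|exact: Shrink_setI].
- move=> _ [->|[X vX <-]]; first exact: large_setT.
  by have [? ? ?] := SMP _ vX; exists (Shrink R q (M R X) x).
have US X : v X -> U (Shrink R q X x) by move=> vX; apply: EU; right; exists X.
have abA X : v X -> alg b X by move=> /vA; apply: algS; exact: ltW.
exists b, (U `&` alg b); split=> //; first exact: ultra_on_trace.
split=> X vX.
  by split; [apply: filterS (US _ vX); exact: Shrink_sub|exact: abA].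
have vM := ultra_on_M uv vX; have [cS _ _] := SMP _ vX.
have [_ _ MX _] := M_spec (vl _ vX).
exists (Shrink R q (M R X) x); split.
- by split; [exact: US|apply: alg_Shrink => //; exact: abA].
- by split=> //; exact: closed_Shrink.
- by apply: subset_trans MX; exact: Shrink_sub.
Qed.

(** * Transfinite iteration *)

Definition below (p r : K * set_system rat) : Prop :=
  (p.1 < r.1)%O /\ refines p.2 r.2.

Definition tower (S : set (K * set_system rat)) : Prop :=
  (forall p, S p -> ultra_on (alg p.1) p.2) /\
  (forall p r, S p -> S r -> [\/ p = r, below p r | below r p]).

Lemma below_trans p r s : below p r -> below r s -> below p s.
Proof.
move=> [pr [sub_pr _]] [rs [sub_rs ref_rs]]; split; first exact: lt_trans rs.
by split=> [X /sub_pr/sub_rs//|X /sub_pr/ref_rs].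
Qed.

Lemma tower_below S p r : tower S -> S p -> S r -> (p.1 < r.1)%O -> below p r.
Proof.
move=> [_ Sc] Sp Sr pr; have [prE|//|[rp _]] := Sc _ _ Sp Sr.
  by move: pr; rewrite prE ltxx.
by have := lt_trans pr rp; rewrite ltxx.
Qed.

Lemma tower_union S : tower S ->
  ultra_on (\bigcup_(p in S) alg p.1) (\bigcup_(p in S) p.2).
Proof.
move=> [Su Sc]; apply: ultra_on_bigcup => // p r Sp Sr.
by have [->|[_ []]|[_ []]] := Sc _ _ Sp Sr; [left|left|right].
Qed.

(** A tower that reaches arbitrarily high measures every set of rationals. *)
Lemma tower_cofinal S : tower S ->
  (forall a, exists2 p, S p & (a < p.1)%O) ->
  exists u, UltraFilter u /\ gruff R u.
Proof.
move=> tS cof; have [_ uC uI ul] := tower_union tS.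
exists (\bigcup_(p in S) p.2); split.
  apply: ultra_of_complement => // [/ul/large_nonempty[]//|X].
  apply: uC; have [a aX] := alg_cover X; have [p Sp ap] := cof a.
  by exists p => //; apply: algS aX; exact: ltW.
move=> X [p Sp pX]; have [r Sr pr] := cof p.1.
have [_ [_ /(_ _ pX)[P [rP perfP PX]]]] := tower_below tS Sp Sr pr.
by exists P; split=> //; exists r.
Qed.

(** The least upper bound [s] of the indices, when it is not attained, is a
    limit; by continuity [alg s] is the union of the algebras of the tower. *)
Lemma tower_bounded S a : tower S -> S !=set0 ->
  (forall p, S p -> (p.1 <= a)%O) ->
  exists t, ultra_on (alg t.1) t.2 /\ forall p, S p -> p = t \/ below p t.
Proof.
move=> tS [p0 Sp0] Sa; have [Su Sc] := tS.
have [[t St tmax]|nomax] :=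
    pselect (exists2 t, S t & forall p, S p -> (p.1 <= t.1)%O).
  exists t; split=> [|p Sp]; first exact: Su.
  have [->|?|[tp _]] := Sc _ _ Sp St; [by left|by right|].
  by have := le_lt_trans (tmax _ Sp) tp; rewrite ltxx.
have next p : S p -> exists2 r, S r & (p.1 < r.1)%O.
  move=> Sp; apply: contrapT => nor; apply: nomax; exists p => // r Sr.
  by rewrite leNgt; apply/negP => pr; apply: nor; exists r.
have [s ubs smin] := well_order_least K_wo
  (ex_intro (fun s => forall p, S p -> (p.1 <= s)%O) a Sa).
have ltS p : S p -> (p.1 < s)%O.
  by move=> /next[r Sr pr]; exact: lt_le_trans pr (ubs _ Sr).
have cof b : (b < s)%O -> exists2 p, S p & (b < p.1)%O.
  move=> bs; apply: contrapT => nop.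
  have /smin : forall p, S p -> (p.1 <= b)%O.
    by move=> p Sp; rewrite leNgt; apply/negP => bp; apply: nop; exists p.
  by rewrite leNgt bs.
have algE : alg s = \bigcup_(p in S) alg p.1.
  have [_ contB _ _ _] := pathB.
  apply/seteqP; split=> [X [h]|X [p Sp]]; last first.
    by apply: algS; exact: ltW (ltS _ Sp).
  rewrite contB; last first.
    split; first by exists p0.1; exact: ltS.
    by move=> b /cof[p Sp bp]; exists p.1 => //; exact: ltS.
  move=> [b /cof[p Sp bp] Bh] <-; exists p => //.
  by apply: (algS (ltW bp)); exists h.
exists (s, \bigcup_(p in S) p.2); split=> [|p Sp].
  by rewrite algE; exact: tower_union.
right; split; first exact: ltS.
have [r Sr pr] := next _ Sp.
have [_ [_ ref]] := tower_below tS Sp Sr pr.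
split=> [X pX|X /ref[P [rP perfP PX]]]; first by exists p.
by exists P; split=> //; exists r.
Qed.

(** Zorn's lemma, applied to the pairs of an index and an ultrafilter of large
    sets on the corresponding algebra, takes the place of a recursion along [K]:
    if no tower were cofinal, every tower would be bounded, and a maximal pair
    would contradict [ultra_on_extend]. *)
Lemma gruff_of_pathway (a0 : K) : exists u, UltraFilter u /\ gruff R u.
Proof.
apply: contrapT => no_u.
have bounded S : tower S -> exists a, forall p, S p -> (p.1 <= a)%O.
  move=> tS; apply: contrapT => nob; apply: no_u; apply: (tower_cofinal tS) => a.
  apply: contrapT => nop; apply: nob; exists a => p Sp.
  by rewrite leNgt; apply/negP => ap; apply: nop; exists p.
pose T := {p : K * set_system rat | ultra_on (alg p.1) p.2}.
pose le (p r : T) := `[< sval p = sval r \/ below (sval p) (sval r) >].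
have [U [UU _ Ul]] : exists U,
    [/\ UltraFilter U, [set setT] `<=` U & U `<=` large R].
  apply: large_ultrafilter; first by exists setT.
    by move=> _ _ -> ->; rewrite setIT.
  by move=> _ ->; exact: large_setT.
pose t0 : T := exist _ (a0, U `&` alg a0) (ultra_on_trace a0 UU Ul).
have [|||t tmax] := @ZL_preorder T t0 le.
- by move=> p; apply/asboolP; left.
- move=> r p s /asboolP rp /asboolP ps; apply/asboolP.
  case: rp => [->//|rp]; case: ps => [<-|ps]; first by right.
  by right; exact: below_trans ps.
- move=> C Ctot; have [[c Cc]|C0] := pselect (C !=set0); last first.
    by exists t0 => p Cp; exfalso; apply: C0; exists p.
  have tC : tower (sval @` C).
    split=> [_ [p Cp <-]|_ _ [p Cp <-] [r Cr <-]]; first exact: (svalP p).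
    by have [/asboolP[->|?]|/asboolP[->|?]] := Ctot _ _ Cp Cr;
      [apply: Or31|apply: Or32|apply: Or31|apply: Or33].
  have [a aC] := bounded _ tC.
  have [|t [ut Ct]] := tower_bounded tC _ aC; first by exists (sval c), c.
  by exists (exist _ t ut) => p Cp; apply/asboolP; apply: Ct; exists p.
have [b [w [tb uw vw]]] := ultra_on_extend (svalP t).
pose s : T := exist _ (b, w) uw.
have /tmax/asboolP : le t s by apply/asboolP; right.
case=> [st|[/= bt _]]; first by move: tb; rewrite -st ltxx.
by have := lt_trans tb bt; rewrite ltxx.
Qed.

End Construction.

Theorem theorem4p4 (R : realType) (q : nat -> rat) (q_enum : bijective q)
    (Code : baire -> set rat) (Dcd : set rat -> baire) (CodeK : cancel Dcd Code)
    (d : Order.disp_t) (K : orderType d) (K_regular : regular_cardinal K) :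
  (exists B : K -> set baire, d_pathway (F_gruff R q Code Dcd) B) ->
  exists u : set_system rat, UltraFilter u /\ gruff R u.
Proof.
move=> [B pathB]; have [K_wo K_inf _ _] := K_regular.
have [a0 _] : [set: K] !=set0.
  apply: contrapT => K0; apply: K_inf; suff -> : [set: K] = set0 by [].
  by rewrite -subset0 => a _; apply: K0; exists a.
exact (gruff_of_pathway q_enum CodeK K_wo pathB a0).
Qed.
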